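(* Let $\alpha,\beta\in[0,1)$ and $\delta\ge 0$, and let $f=h+\overline{g}\in\mathcal{S}_H^{\delta}[\alpha,\beta]$, where $h(z)=\sum_{n=0}^{\infty}a_nz^n$ and $g(z)=\sum_{n=1}^{\infty}b_nz^n$ for $z\in\mathbb{D}$. Then $$|b_2|\le \frac{(1-\alpha)\beta}{2^{\delta}(2-\alpha)}+\frac{1-\beta^2}{2},$$ and for every integer $n\ge 3$, $$|b_n|\le \frac{(1-\alpha)(1-\beta^2)}{n}\sum_{k=1}^{n-1}\frac{k^{1-\delta}}{k-\alpha}+\frac{(1-\alpha)\beta}{n^{\delta}(n-\alpha)}.$$
   Context: $\mathbb{D}=\{z\in\mathbb{C}:|z|<1\}$. For $0\le\alpha<1$ and real $\delta$, $\mathcal{S}^{\delta}[\alpha]$ is the class of functions $h$ holomorphic in $\mathbb{D}$ of the form $h(z)=z+\sum_{n=2}^{\infty}a_nz^n$ (so $a_0=0$, $a_1=1$) with $\sum_{n=2}^{\infty}n^{\delta}\frac{n-\alpha}{1-\alpha}|a_n|\le 1$. $\mathcal{H}$ is the set of complex-valued harmonic functions $f=h+\overline{g}$ on $\mathbb{D}$, with $h(z)=\sum_{n\ge0}a_nz^n$ and $g(z)=\sum_{n\ge1}b_nz^n$ holomorphic in $\mathbb{D}$ (so $g(0)=0$), that are locally univalent and sense-preserving, i.e. $|g'(z)|<|h'(z)|$ for all $z\in\mathbb{D}$. For $\alpha,\beta\in[0,1)$ and real $\delta$, $\mathcal{S}_H^{\delta}[\alpha,\beta]$ is the set of $f=h+\overline{g}\in\mathcal{H}$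 such that $h\in\mathcal{S}^{\delta}[\alpha]$ and $|b_1|=\beta$. *)

(* Defs.v *)
From Stdlib Require Import Reals.
From Coquelicot Require Import Coquelicot.
Open Scope R_scope.

(* Complex functions are total; only their values on the open unit disc matter. *)
Definition in_disc (z : C) : Prop := Cmod z < 1.

Definition holomorphic_on_disc (h : C -> C) : Prop :=
  forall z : C, in_disc z -> @ex_derive C_AbsRing C_NormedModule h z.

Definition power_series_on_disc (a : nat -> C) (h : C -> C) : Prop :=
  forall z : C, in_disc z -> @is_pseries C_AbsRing C_NormedModule a z (h z).

(* u is of class C^2 with zero Laplacian; [ex_diff_n u 2 x y] is twice
   continuous differentiability, stated pointwise. *)
Definition real_harmonic_on_disc (u : R -> R -> R) : Prop :=
  forall x y : R, in_disc (x, y) ->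
    ex_diff_n u 2 x y /\ partial_derive 2 0 u x y + partial_derive 0 2 u x y = 0.

Definition harmonic_on_disc (f : C -> C) : Prop :=
  real_harmonic_on_disc (fun x y => Re (f (x, y))) /\
  real_harmonic_on_disc (fun x y => Im (f (x, y))).

(* h belongs to S^delta[alpha]. The series is shifted so that its index starts
   at n = 2; [Rpower] is only used at positive base. *)
Definition class_S (delta alpha : R) (h : C -> C) : Prop :=
  let term (a : nat -> C) (n : nat) :=
    Rpower (INR n) delta * ((INR n - alpha) / (1 - alpha)) * Cmod (a n) in
  holomorphic_on_disc h /\
  exists a : nat -> C,
    power_series_on_disc a h /\ a 0%nat = RtoC 0 /\ a 1%nat = RtoC 1 /\
    ex_series (fun k => term a (k + 2)%nat) /\
    Series (fun k => term a (k + 2)%nat) <= 1.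

(* f = h + conj g belongs to H. The normalisation g(0) = 0 (no constant term in
   the expansion of g) makes h and g unique on the disc, so membership of f is
   stated together with this decomposition. [C_derive] is the complex
   derivative wherever it exists, in particular for holomorphic functions. *)
Definition class_H (f h g : C -> C) : Prop :=
  harmonic_on_disc f /\
  holomorphic_on_disc h /\ holomorphic_on_disc g /\ g (RtoC 0) = RtoC 0 /\
  (forall z : C, in_disc z -> f z = Cplus (h z) (Cconj (g z))) /\
  (forall z : C, in_disc z -> Cmod (C_derive g z) < Cmod (C_derive h z)).

Definition class_SH (delta alpha beta : R) (f h g : C -> C) : Prop :=
  class_H f h g /\ class_S delta alpha h /\
  exists b : nat -> C, power_series_on_disc b g /\ Cmod (b 1%nat) = beta.

(* Main.v *)
Require Import Defs.
From Stdlib Require Import Reals Lra Lia.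
From Coquelicot Require Import Coquelicot.
Open Scope R_scope.

(** Since |g'| < |h'| on the disc, g' = w h' for an analytic w bounded by 1,
    the dilatation, and w(0) = b_1 because h'(0) = 1.  Comparing coefficients,
      n b_n = sum_(k = 1)^n k a_k w_(n - k),
    so that |w_0| = beta, |w_j| <= 1 - beta^2 for j >= 1 and
    |a_k| <= (1 - alpha) / (k^delta (k - alpha)) give both inequalities at once
    ([coef_bound_of_convolution]); the bound on |a_k| is read off a single term
    of the series that defines the class.

    The analyticity of w is read off the coefficients.  As delta >= 0, the class
    condition gives sum_(n >= 2) n |a_n| <= 1, so h' = 1 + (a series whose
    coefficients have absolute sum at most 1).  The formal quotient w of g' by h'
    then satisfies |w_n| <= |b'_0| + ... + |b'_n|, where b' are the coefficients of
    g' ([quotient_coef_le]), and hence converges on the whole disc.  Cauchy's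
    product identifies its sum with g'/h' ([dilatation_coefs]).

    The estimate |w_n| <= 1 - |w_0|^2 for |w| <= 1 ([bounded_power_series_coef])
    comes from a finite computation.  Averaging a polynomial W against the kernel
    z^(-n) (1 + t z^n)^2 over enough roots of unity extracts W_n + 2 t W_0, while
    the modulus of the kernel averages to 1 + |t|^2.  If |W| <= M on the circle,
    this yields |W_n + 2 t W_0| <= M (1 + |t|^2) ([poly_coef_bound]).  With
    |t| = |W_0| and the argument of t chosen to align the two terms, it becomes
    |W_n| + 2 |W_0|^2 <= M (1 + |W_0|^2); truncating w(r z), then letting M and r
    tend to 1, gives the estimate. *)

(** * Complex series *)

Notation is_Cseries u l := (@is_series C_AbsRing C_NormedModule u l).

Lemma pow_n_Cpow (z : C) (n : nat) : @pow_n C_AbsRing z n = (z ^ n)%C.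
Proof.
  induction n as [|n IH]; [reflexivity|].
  rewrite Cpow_S, <- IH. reflexivity.
Qed.

Lemma Re_sum_n (u : nat -> C) (n : nat) :
  Re (sum_n u n) = sum_n (fun k => Re (u k)) n.
Proof.
  induction n as [|n IH]; [now rewrite !sum_O|].
  rewrite !sum_Sn, <- IH. reflexivity.
Qed.

Lemma Im_sum_n (u : nat -> C) (n : nat) :
  Im (sum_n u n) = sum_n (fun k => Im (u k)) n.
Proof.
  induction n as [|n IH]; [now rewrite !sum_O|].
  rewrite !sum_Sn, <- IH. reflexivity.
Qed.

Lemma is_Cseries_components (u : nat -> C) (l : C) :
  is_Cseries u l <->
  is_series (fun n => Re (u n)) (Re l) /\ is_series (fun n => Im (u n)) (Im l).
Proof.
  split.
  - intros H.
    pose proof (proj1 (@filterlim_locally _ C_UniformSpace eventually _ (sum_n u) l) H)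
      as H'. clear H.
    split; apply filterlim_locally; intros eps; generalize (H' eps); apply filter_imp;
      intros n [H1 H2].
    + rewrite <- Re_sum_n. exact H1.
    + rewrite <- Im_sum_n. exact H2.
  - intros [H1 H2].
    apply (@filterlim_locally _ C_UniformSpace eventually _ (sum_n u) l). intros eps.
    pose proof (proj1 (filterlim_locally _ _) H1 eps) as A.
    pose proof (proj1 (filterlim_locally _ _) H2 eps) as B.
    generalize (filter_and _ _ A B). apply filter_imp. clear A B. intros n [A B].
    rewrite <- Re_sum_n in A. rewrite <- Im_sum_n in B. split; assumption.
Qed.

Lemma im_le_Cmod (z : C) : Rabs (Im z) <= Cmod z.
Proof. eapply Rle_trans; [apply Rmax_r|apply Rmax_Cmod]. Qed.

Lemma Cmod_le_components (z : C) : Cmod z <= Rabs (Re z) + Rabs (Im z).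
Proof.
  replace z with (RtoC (Re z) + Ci * RtoC (Im z))%C at 1.
  - eapply Rle_trans; [apply Cmod_triangle|].
    rewrite Cmod_mult, Cmod_Ci, !Cmod_R. lra.
  - destruct z; unfold Cplus, Cmult, Ci, RtoC; simpl. f_equal; ring.
Qed.

Lemma Cmod_minus_sym (x y : C) : Cmod (x - y) = Cmod (y - x).
Proof. rewrite <- Cmod_opp. f_equal. ring. Qed.

Lemma ex_Cseries_abs (u : nat -> C) (v : nat -> R) :
  (forall n, Cmod (u n) <= v n) -> ex_series v -> exists l, is_Cseries u l.
Proof.
  intros H Hv. exact (@ex_series_le C_AbsRing C_CompleteNormedModule u v H Hv).
Qed.

Lemma Cmod_sum_n_m (u : nat -> C) (v : nat -> R) (n m : nat) :
  (forall k, Cmod (u k) <= v k) ->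
  Cmod (sum_n_m (G := C_AbelianMonoid) u n m) <= sum_n_m v n m.
Proof.
  intros H.
  eapply Rle_trans; [exact (@norm_sum_n_m C_AbsRing C_NormedModule u n m)|].
  apply sum_n_m_le. exact H.
Qed.

(** Each block of the tail is dominated by the same block of the majorant; the
    comparison survives the passage to the limit. *)
Lemma Cmod_tail_le (u : nat -> C) (l : C) (v : nat -> R) (s : R) (N : nat) :
  (forall k, Cmod (u k) <= v k) -> is_Cseries u l -> is_series v s ->
  Cmod (l - sum_n u N) <= s - sum_n v N.
Proof.
  intros H Hu Hv. apply le_epsilon. intros eps He.
  assert (He' : 0 < eps / 2) by lra.
  pose proof (proj1 (@filterlim_locally_ball_norm C_AbsRing _ C_NormedModule
     eventually _ (sum_n u) l) Hu (mkposreal _ He')) as H1.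
  pose proof (proj1 (@filterlim_locally_ball_norm R_AbsRing _ R_NormedModule
     eventually _ (sum_n v) s) Hv (mkposreal _ He')) as H2.
  destruct (filter_and _ _ H1 H2) as [K HK].
  destruct (HK (K + S N)%nat) as [A B]; [lia|]. clear HK H1 H2.
  set (M := (K + S N)%nat) in *.
  assert (HM : (N <= M)%nat) by (unfold M; lia).
  change (Cmod (sum_n u M - l) < eps / 2) in A.
  change (Rabs (sum_n v M - s) < eps / 2) in B.
  apply Rabs_def2 in B.
  rewrite Cmod_minus_sym in A.
  replace (l - sum_n u N)%C with ((l - sum_n u M) + (sum_n u M - sum_n u N))%C by ring.
  eapply Rle_trans; [apply Cmod_triangle|].
  assert (D : Cmod (sum_n u M - sum_n u N) <= sum_n v M - sum_n v N).
  { assert (E1 : sum_n_m (G := C_AbelianMonoid) u (S N) M = (sum_n u M - sum_n u N)%C)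
      by exact (@sum_n_m_sum_n C_AbelianGroup u N M HM).
    assert (E2 : sum_n_m v (S N) M = sum_n v M - sum_n v N)
      by exact (@sum_n_m_sum_n R_AbelianGroup v N M HM).
    rewrite <- E1, <- E2. apply Cmod_sum_n_m, H. }
  lra.
Qed.

Lemma Cmod_series_le (u : nat -> C) (l : C) (v : nat -> R) (s : R) :
  (forall k, Cmod (u k) <= v k) -> is_Cseries u l -> is_series v s ->
  Cmod l <= s.
Proof.
  intros H Hu Hv. pose proof (Cmod_tail_le u l v s 0 H Hu Hv) as T.
  rewrite !sum_O in T. specialize (H 0%nat).
  replace l with ((l - u 0%nat) + u 0%nat)%C by ring.
  eapply Rle_trans; [apply Cmod_triangle|]. lra.
Qed.

Definition Cauchy_coef (a b : nat -> C) (n : nat) : C :=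
  sum_n (fun k => a k * b (n - k)%nat)%C n.

(** Mertens' theorem for real series, applied to the four products of real and
    imaginary parts. *)
Lemma is_Cseries_mult (a b : nat -> C) (la lb : C) :
  is_Cseries a la -> is_Cseries b lb ->
  ex_series (fun n => Cmod (a n)) -> ex_series (fun n => Cmod (b n)) ->
  is_Cseries (Cauchy_coef a b) (la * lb)%C.
Proof.
  intros Ha Hb Aa Ab.
  apply is_Cseries_components in Ha. apply is_Cseries_components in Hb.
  destruct Ha as [Ha1 Ha2], Hb as [Hb1 Hb2].
  assert (Re_abs : forall c : nat -> C, ex_series (fun n => Cmod (c n)) ->
     ex_series (fun n => Rabs (Re (c n)))).
  { intros c. apply (@ex_series_le R_AbsRing R_CompleteNormedModule).
    intros n. change (Rabs (Rabs (Re (c n))) <= Cmod (c n)).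
    rewrite Rabs_Rabsolu. apply re_le_Cmod. }
  assert (Im_abs : forall c : nat -> C, ex_series (fun n => Cmod (c n)) ->
     ex_series (fun n => Rabs (Im (c n)))).
  { intros c. apply (@ex_series_le R_AbsRing R_CompleteNormedModule).
    intros n. change (Rabs (Rabs (Im (c n))) <= Cmod (c n)).
    rewrite Rabs_Rabsolu. apply im_le_Cmod. }
  apply is_Cseries_components. split.
  - pose proof (is_series_minus _ _ _ _
      (is_series_mult _ _ _ _ Ha1 Hb1 (Re_abs _ Aa) (Re_abs _ Ab))
      (is_series_mult _ _ _ _ Ha2 Hb2 (Im_abs _ Aa) (Im_abs _ Ab))) as H.
    revert H. apply is_series_ext. intros n.
    unfold Cauchy_coef. rewrite Re_sum_n, <- !sum_n_Reals.
    change (minus (sum_n (fun k => Re (a k) * Re (b (n - k)%nat)) n)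
       (sum_n (fun k => Im (a k) * Im (b (n - k)%nat)) n) =
       sum_n (fun k => Re (a k) * Re (b (n - k)%nat) - Im (a k) * Im (b (n - k)%nat)) n).
    rewrite !sum_n_Reals, minus_sum. reflexivity.
  - pose proof (is_series_plus _ _ _ _
      (is_series_mult _ _ _ _ Ha1 Hb2 (Re_abs _ Aa) (Im_abs _ Ab))
      (is_series_mult _ _ _ _ Ha2 Hb1 (Im_abs _ Aa) (Re_abs _ Ab))) as H.
    revert H. apply is_series_ext. intros n.
    unfold Cauchy_coef. rewrite Im_sum_n, <- !sum_n_Reals, <- sum_n_plus.
    reflexivity.
Qed.

Lemma is_Cseries_unique (u : nat -> C) (l1 l2 : C) :
  is_Cseries u l1 -> is_Cseries u l2 -> l1 = l2.
Proof.
  intros H1 H2. apply is_Cseries_components in H1, H2.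
  destruct H1 as [A1 B1], H2 as [A2 B2].
  apply is_series_unique in A1, A2, B1, B2.
  destruct l1, l2; simpl in *. f_equal; congruence.
Qed.

Lemma is_Cseries_head (u : nat -> C) :
  (forall n, u (S n) = RtoC 0) -> is_Cseries u (u 0%nat).
Proof.
  intros H. apply filterlim_ext with (fun _ : nat => u 0%nat); [|apply filterlim_const].
  intros n. induction n as [|n IH]; [now rewrite sum_O|].
  rewrite sum_Sn, <- IH, H. symmetry. apply Cplus_0_r.
Qed.

(** * Power series on the unit disc and their complex derivative *)

(** Absolute convergence on every smaller closed disc: on coefficients alone, this
    says that the radius of convergence is at least 1. *)
Definition disc_summable (c : nat -> C) : Prop :=
  forall r : R, 0 <= r < 1 -> ex_series (fun n => Cmod (c n) * r ^ n).

Definition deriv_coef (c : nat -> C) (n : nat) : C := (RtoC (INR (S n)) * c (S n))%C.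

(** The terms of a convergent series tend to 0, which fails outside the disc of
    convergence. *)
Lemma CV_radius_ge_of_ex_series (a : nat -> R) (x : R) :
  ex_series (fun n => a n * x ^ n) -> Rbar_le (Rabs x) (CV_radius a).
Proof.
  intros H. apply Rbar_not_lt_le. intros Hlt.
  apply (CV_disk_outside a x Hlt). now apply ex_series_lim_0.
Qed.

Lemma is_pseries_Cpow (c : nat -> C) (z l : C) :
  @is_pseries C_AbsRing C_NormedModule c z l ->
  is_Cseries (fun n => c n * z ^ n)%C l.
Proof.
  apply is_series_ext. intros n. rewrite pow_n_Cpow.
  change ((z ^ n * c n)%C = (c n * z ^ n)%C). ring.
Qed.

(** Convergence at a point of modulus strictly between r and 1 bounds the radius of
    convergence below.  The real theory applies to the real and imaginary parts of
    the coefficients when that point is taken on the real axis. *)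
Lemma power_series_summable (c : nat -> C) (h : C -> C) :
  power_series_on_disc c h -> disc_summable c.
Proof.
  intros H r Hr.
  set (rho := (1 + r) / 2).
  assert (Hrho : in_disc (RtoC rho)).
  { unfold in_disc, rho. rewrite Cmod_R, Rabs_pos_eq; lra. }
  pose proof (is_pseries_Cpow _ _ _ (H _ Hrho)) as Hs.
  apply is_Cseries_components in Hs. destruct Hs as [H1 H2].
  assert (K : forall p : C -> R, (forall (x : C) (t : R), p (x * RtoC t)%C = p x * t) ->
      ex_series (fun n => p (c n * RtoC rho ^ n)%C) ->
      ex_series (fun n => Rabs (p (c n) * r ^ n))).
  { intros p Hp Hex. apply CV_disk_inside.
    assert (Rbar_le (Rabs rho) (CV_radius (fun n => p (c n)))) as Hle.
    { apply CV_radius_ge_of_ex_series. revert Hex. apply ex_series_ext.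
      intros n. now rewrite <- RtoC_pow, Hp. }
    eapply Rbar_lt_le_trans; [|exact Hle]. simpl.
    rewrite !Rabs_pos_eq; unfold rho; lra. }
  assert (K1 : ex_series (fun n => Rabs (Re (c n) * r ^ n))).
  { apply K; [intros [x1 x2] t; simpl; ring|]. now exists (Re (h (RtoC rho))). }
  assert (K2 : ex_series (fun n => Rabs (Im (c n) * r ^ n))).
  { apply K; [intros [x1 x2] t; simpl; ring|]. now exists (Im (h (RtoC rho))). }
  pose proof (ex_series_plus _ _ K1 K2) as K3. revert K3.
  apply (@ex_series_le R_AbsRing R_CompleteNormedModule).
  intros n. change (Rabs (Cmod (c n) * r ^ n) <=
    Rabs (Re (c n) * r ^ n) + Rabs (Im (c n) * r ^ n)).
  assert (Hp : 0 <= r ^ n) by (apply pow_le; lra).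
  rewrite !Rabs_mult, (Rabs_pos_eq (r ^ n)), (Rabs_pos_eq (Cmod _)) by
    first [assumption | apply Cmod_ge_0].
  pose proof (Cmod_le_components (c n)) as Hc.
  rewrite <- Rmult_plus_distr_r. now apply Rmult_le_compat_r.
Qed.

Lemma Cmod_deriv_coef (c : nat -> C) (n : nat) :
  Cmod (deriv_coef c n) = INR (S n) * Cmod (c (S n)).
Proof.
  unfold deriv_coef. rewrite Cmod_mult, Cmod_R, Rabs_pos_eq; [reflexivity|apply pos_INR].
Qed.

Lemma disc_summable_deriv_coef (c : nat -> C) : disc_summable c -> disc_summable (deriv_coef c).
Proof.
  intros H r Hr.
  set (a := fun n => Cmod (c n)).
  set (rho := (1 + r) / 2).
  assert (Hle : Rbar_le (Rabs rho) (CV_radius a)).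
  { apply CV_radius_ge_of_ex_series, H. unfold rho; lra. }
  rewrite <- CV_radius_derive in Hle.
  assert (Hlt : Rbar_lt (Rabs r) (CV_radius (PS_derive a))).
  { eapply Rbar_lt_le_trans; [|exact Hle]. simpl.
    rewrite !Rabs_pos_eq; unfold rho; lra. }
  generalize (CV_disk_inside _ _ Hlt). apply ex_series_ext. intros n.
  unfold PS_derive, a. rewrite Cmod_deriv_coef, Rabs_pos_eq; [reflexivity|].
  repeat apply Rmult_le_pos; [apply pos_INR|apply Cmod_ge_0|apply pow_le; lra].
Qed.

Lemma disc_summable_abs (c : nat -> C) (z : C) :
  disc_summable c -> in_disc z -> ex_series (fun n => Cmod (c n * z ^ n)%C).
Proof.
  intros H Hz.
  generalize (H (Cmod z) (conj (Cmod_ge_0 z) Hz)). apply ex_series_ext.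
  intros n. now rewrite Cmod_mult, Cmod_pow.
Qed.

Lemma disc_summable_ex (c : nat -> C) (z : C) :
  disc_summable c -> in_disc z -> exists l, is_Cseries (fun n => c n * z ^ n)%C l.
Proof.
  intros H Hz. eapply ex_Cseries_abs; [|exact (disc_summable_abs c z H Hz)].
  intros n. apply Rle_refl.
Qed.

Lemma pow_increment_le (y z : C) (rho : R) (m : nat) :
  Cmod y <= rho -> Cmod z <= rho ->
  Cmod (y ^ S m - z ^ S m) <= Cmod (y - z) * (INR (S m) * rho ^ m).
Proof.
  intros Hy Hz. pose proof (Cmod_ge_0 z) as Hz0.
  induction m as [|m IH].
  - rewrite !Cpow_1_r. simpl. lra.
  - replace (y ^ S (S m) - z ^ S (S m))%C
      with (z * (y ^ S m - z ^ S m) + (y - z) * y ^ S m)%C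
      by (rewrite (Cpow_S y (S m)), (Cpow_S z (S m)); ring).
    eapply Rle_trans; [apply Cmod_triangle|]. rewrite !Cmod_mult, Cmod_pow.
    assert (A : Cmod y ^ S m <= rho ^ S m).
    { apply pow_incr. split; [apply Cmod_ge_0|assumption]. }
    pose proof (Cmod_ge_0 (y - z)) as P.
    assert (B : Cmod z * Cmod (y ^ S m - z ^ S m) <=
       rho * (Cmod (y - z) * (INR (S m) * rho ^ m))).
    { apply Rmult_le_compat; auto. apply Cmod_ge_0. }
    pose proof (Rmult_le_compat_l _ _ _ P A) as E.
    rewrite (S_INR (S m)). simpl (rho ^ S m) in *. nra.
Qed.

(** With E_n the error of the first-order expansion of y^n at z,
    E_(n+1) = z E_n + (y - z) (y^n - z^n).  The crude constant (m+1)(m+2) is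
    exactly the factor of the second termwise derivative. *)
Lemma pow_taylor_le (y z : C) (rho : R) (m : nat) :
  Cmod y <= rho -> Cmod z <= rho ->
  Cmod (y ^ S (S m) - z ^ S (S m) - (y - z) * (RtoC (INR (S (S m))) * z ^ S m))
  <= Cmod (y - z) ^ 2 * (INR (S m) * INR (S (S m)) * rho ^ m).
Proof.
  intros Hy Hz. pose proof (Cmod_ge_0 z) as Hz0.
  pose proof (Cmod_ge_0 (y - z)) as P.
  assert (Hr0 : 0 <= rho) by lra.
  induction m as [|m IH].
  - replace (y ^ 2 - z ^ 2 - (y - z) * (RtoC (INR 2) * z ^ 1))%C with ((y - z) ^ 2)%C.
    + rewrite Cmod_pow. simpl. nra.
    + replace (RtoC (INR 2)) with (1 + 1)%C.
      * ring.
      * rewrite <- RtoC_plus. reflexivity.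
  - replace (y ^ S (S (S m)) - z ^ S (S (S m)) -
       (y - z) * (RtoC (INR (S (S (S m)))) * z ^ S (S m)))%C
      with (z * (y ^ S (S m) - z ^ S (S m) - (y - z) * (RtoC (INR (S (S m))) * z ^ S m))
            + (y - z) * (y ^ S (S m) - z ^ S (S m)))%C.
    2:{ rewrite (S_INR (S (S m))), RtoC_plus.
        rewrite (Cpow_S y (S (S m))), (Cpow_S z (S (S m))), (Cpow_S z (S m)). ring. }
    eapply Rle_trans; [apply Cmod_triangle|]. rewrite !Cmod_mult.
    pose proof (pow_increment_le y z rho (S m) Hy Hz) as A.
    apply (Rmult_le_compat_l _ _ _ P) in A.
    pose proof (Rmult_le_compat _ _ _ _ Hz0 (Cmod_ge_0 _) Hz IH) as B.
    eapply Rle_trans; [apply Rplus_le_compat; [exact B|exact A]|].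
    assert (Hpos : 0 <= Cmod (y - z) ^ 2 * rho ^ S m).
    { apply Rmult_le_pos; apply pow_le; assumption. }
    rewrite (S_INR (S (S m))), (S_INR (S m)).
    replace (rho * (Cmod (y - z) ^ 2 * (INR (S m) * (INR (S m) + 1) * rho ^ m)) +
      Cmod (y - z) * (Cmod (y - z) * ((INR (S m) + 1) * rho ^ S m))) with
      ((INR (S m) + 1) * (INR (S m) + 1) * (Cmod (y - z) ^ 2 * rho ^ S m))
      by (simpl; ring).
    replace (Cmod (y - z) ^ 2 * ((INR (S m) + 1) * (INR (S m) + 1 + 1) * rho ^ S m)) with
      ((INR (S m) + 1) * (INR (S m) + 1 + 1) * (Cmod (y - z) ^ 2 * rho ^ S m)) by ring.
    apply Rmult_le_compat_r; [assumption|].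
    pose proof (pos_INR (S m)). nra.
Qed.

(** Summing [pow_taylor_le] against the coefficients bounds the first-order error by
    |y - z|^2 times the second derivative of the majorant series, which is finite on
    a closed disc of radius rho < 1 containing z in its interior. *)
Lemma Cpower_series_is_derive (c : nat -> C) (f : C -> C) (z l : C) :
  power_series_on_disc c f -> in_disc z ->
  is_Cseries (fun n => deriv_coef c n * z ^ n)%C l ->
  @is_derive C_AbsRing C_NormedModule f z l.
Proof.
  intros Hf Hz Hl. pose proof (power_series_summable _ _ Hf) as Hs.
  unfold in_disc in Hz. pose proof (Cmod_ge_0 z) as Hz0.
  set (rho := (1 + Cmod z) / 2).
  assert (Hrho : 0 <= rho < 1) by (unfold rho; lra).
  (* The two lowest powers have no second-order error. *)
  set (v := fun n => match n with
     | S (S m) => Cmod (deriv_coef (deriv_coef c) m) * rho ^ m | _ => 0 end).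
  assert (Hv : ex_series v).
  { apply ex_series_incr_1, ex_series_incr_1.
    exact (disc_summable_deriv_coef _ (disc_summable_deriv_coef _ Hs) rho Hrho). }
  destruct Hv as [s0 Hv]. set (s := Rabs s0).
  assert (Hs0 : 0 <= s) by apply Rabs_pos.
  assert (Key : forall y, Cmod y <= rho ->
    Cmod (f y - f z - (y - z) * l) <= Cmod (y - z) ^ 2 * s).
  { intros y Hy.
    assert (Hl' : is_Cseries (fun n => RtoC (INR n) * c n * z ^ pred n)%C l).
    { apply is_series_decr_1.
      refine (eq_ind l (fun x : C => is_Cseries _ x) Hl _ _).
      change (l = l + - (RtoC (INR 0) * c 0%nat * z ^ pred 0))%C.
      simpl INR. ring. }
    assert (Hy' : in_disc y) by (unfold in_disc; lra).
    pose proof (is_series_minus _ _ _ _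
       (is_series_minus _ _ _ _ (is_pseries_Cpow _ _ _ (Hf _ Hy'))
          (is_pseries_Cpow _ _ _ (Hf _ Hz)))
       (is_series_scal_l (y - z)%C _ _ Hl')) as H.
    pose proof (is_series_scal_l (Cmod (y - z) ^ 2) v s0 Hv) as Hv2.
    apply Rle_trans with (Cmod (y - z) ^ 2 * s0).
    2:{ apply Rmult_le_compat_l; [apply pow2_ge_0|apply Rle_abs]. }
    refine (Cmod_series_le _ _ _ _ _ H Hv2).
    intros k.
    change (Cmod (c k * y ^ k - c k * z ^ k -
      (y - z) * (RtoC (INR k) * c k * z ^ pred k)) <= Cmod (y - z) ^ 2 * v k).
    replace (c k * y ^ k - c k * z ^ k - (y - z) * (RtoC (INR k) * c k * z ^ pred k))%C
     with (c k * (y ^ k - z ^ k - (y - z) * (RtoC (INR k) * z ^ pred k)))%C by ring.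
    destruct k as [|[|m]].
    - simpl INR. simpl v.
      match goal with |- Cmod ?x <= _ => replace x with (RtoC 0) end.
      + rewrite Cmod_0. lra.
      + simpl. ring.
    - simpl INR. simpl v.
      match goal with |- Cmod ?x <= _ => replace x with (RtoC 0) end.
      + rewrite Cmod_0. lra.
      + simpl. ring.
    - rewrite Cmod_mult. unfold v. rewrite !Cmod_deriv_coef. simpl pred.
      assert (Hzr : Cmod z <= rho) by (unfold rho; lra).
      pose proof (pow_taylor_le y z rho m Hy Hzr) as T.
      apply (Rmult_le_compat_l _ _ _ (Cmod_ge_0 (c (S (S m))))) in T.
      eapply Rle_trans; [exact T|]. apply Req_le. ring. }
  split.
  - apply is_linear_scal_l.
  - intros x Hx.
    apply (@is_filter_lim_locally_unique C_AbsRing (AbsRing_NormedModule C_AbsRing)) in Hx.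
    subst x.
    intros eps.
    (* Staying within d keeps y in the disc of radius rho and makes |y - z| s <= eps. *)
    set (d := Rmin (rho - Cmod z) (eps / (s + 1))).
    assert (Hd : 0 < d).
    { apply Rmin_pos; [unfold rho; lra|].
      apply Rdiv_lt_0_compat; [apply cond_pos|lra]. }
    exists (mkposreal d Hd). intros y Hy.
    change (Cmod (y - z) < d) in Hy.
    change (Cmod (f y - f z - (y - z) * l) <= eps * Cmod (y - z)).
    assert (Hy1 : Cmod y <= rho).
    { replace y with ((y - z) + z)%C by ring.
      eapply Rle_trans; [apply Cmod_triangle|].
      pose proof (Rmin_l (rho - Cmod z) (eps / (s + 1))). unfold d in Hy. lra. }
    eapply Rle_trans; [exact (Key y Hy1)|].
    assert (Hy2 : Cmod (y - z) * (s + 1) <= eps).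
    { assert (Cmod (y - z) <= eps / (s + 1)).
      { pose proof (Rmin_r (rho - Cmod z) (eps / (s + 1))). unfold d in Hy. lra. }
      apply (Rmult_le_compat_r (s + 1)) in H; [|lra].
      replace (eps / (s + 1) * (s + 1)) with (pos eps) in H by (field; lra). exact H. }
    pose proof (Cmod_ge_0 (y - z)). simpl. nra.
Qed.

Lemma C_derive_series (c : nat -> C) (f : C -> C) (z : C) :
  power_series_on_disc c f -> in_disc z ->
  is_Cseries (fun n => deriv_coef c n * z ^ n)%C (C_derive f z).
Proof.
  intros Hf Hz.
  destruct (disc_summable_ex (deriv_coef c) z
    (disc_summable_deriv_coef _ (power_series_summable _ _ Hf)) Hz) as [l Hl].
  now rewrite (is_C_derive_unique f z l (Cpower_series_is_derive c f z l Hf Hz Hl)).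
Qed.

Lemma C_derive_0 (c : nat -> C) (f : C -> C) :
  power_series_on_disc c f -> C_derive f (RtoC 0) = c 1%nat.
Proof.
  intros Hc. assert (H0 : in_disc (RtoC 0)) by (unfold in_disc; rewrite Cmod_0; lra).
  assert (Htail : forall n, (deriv_coef c (S n) * RtoC 0 ^ S n)%C = RtoC 0)
    by (intros n; rewrite Cpow_S; ring).
  rewrite (is_Cseries_unique _ _ _ (C_derive_series c f _ Hc H0)
     (is_Cseries_head (fun n => deriv_coef c n * RtoC 0 ^ n)%C Htail)).
  unfold deriv_coef. simpl. ring.
Qed.

(** * Means over roots of unity *)

Definition cis (t : R) : C := (cos t, sin t).

Lemma Cmod_cis (t : R) : Cmod (cis t) = 1.
Proof.
  unfold Cmod, cis. simpl fst. simpl snd.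
  rewrite <- !Rsqr_pow2, Rplus_comm, sin2_cos2. apply sqrt_1.
Qed.

Lemma cis_pow (t : R) (n : nat) : (cis t ^ n)%C = cis (INR n * t).
Proof.
  induction n as [|n IH].
  - simpl. unfold cis. rewrite Rmult_0_l, cos_0, sin_0. reflexivity.
  - rewrite Cpow_S, IH, S_INR. unfold cis.
    replace ((INR n + 1) * t) with (t + INR n * t) by ring.
    rewrite cos_plus, sin_plus. unfold Cmult; simpl. f_equal; ring.
Qed.

(** The primitive root of order N + 1: the shift makes the order positive and matches
    sums over indices 0, ..., N. *)
Definition unity_root (N : nat) : C := cis (2 * PI / INR (S N)).

Lemma unity_root_pow_order (N : nat) : (unity_root N ^ S N)%C = RtoC 1.
Proof.
  unfold unity_root. rewrite cis_pow.
  replace (INR (S N) * (2 * PI / INR (S N))) with (2 * PI)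
    by (field; apply not_0_INR; lia).
  unfold cis. rewrite cos_2PI, sin_2PI. reflexivity.
Qed.

Lemma unity_root_pow_neq_1 (N m : nat) : (0 < m < S N)%nat -> (unity_root N ^ m)%C <> RtoC 1.
Proof.
  intros Hm. unfold unity_root. rewrite cis_pow.
  set (t := INR m * (2 * PI / INR (S N))).
  assert (Ht : 0 < t < 2 * PI).
  { pose proof PI_RGT_0. assert (HN : 0 < INR (S N)) by (apply lt_0_INR; lia).
    assert (H1 : 0 < INR m) by (apply lt_0_INR; lia).
    assert (H2 : INR m < INR (S N)) by (apply lt_INR; lia).
    assert (E : t * INR (S N) = INR m * (2 * PI)) by (unfold t; field; lra).
    split; nra. }
  intros E. injection E as E1 E2.
  replace t with (2 * (t / 2)) in E1 by field.
  rewrite cos_2a_sin in E1.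
  assert (0 < sin (t / 2)) by (apply sin_gt_0; lra).
  nra.
Qed.

Definition mean (N : nat) (F : C -> C) : C :=
  (/ RtoC (INR (S N)) * sum_n (fun j => F (unity_root N ^ j)) N)%C.

Lemma mean_ext (N : nat) (F G : C -> C) :
  (forall z, Cmod z = 1 -> F z = G z) -> mean N F = mean N G.
Proof.
  intros H. unfold mean. f_equal. apply sum_n_ext. intros j. apply H.
  unfold unity_root. now rewrite Cmod_pow, Cmod_cis, pow1.
Qed.

Lemma mean_plus (N : nat) (F G : C -> C) :
  mean N (fun z => F z + G z)%C = (mean N F + mean N G)%C.
Proof.
  unfold mean.
  rewrite (sum_n_plus (G := C_AbelianMonoid)
    (fun j => F (unity_root N ^ j)%C) (fun j => G (unity_root N ^ j)%C) N
    : sum_n (fun j => F (unity_root N ^ j) + G (unity_root N ^ j))%C N = _).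
  apply Cmult_plus_distr_l.
Qed.

Lemma mean_scal (N : nat) (c : C) (F : C -> C) :
  mean N (fun z => c * F z)%C = (c * mean N F)%C.
Proof.
  unfold mean.
  rewrite (sum_n_mult_l (K := C_Ring) c (fun j => F (unity_root N ^ j)%C) N
    : sum_n (fun j => c * F (unity_root N ^ j))%C N = _).
  change (/ RtoC (INR (S N)) * (c * sum_n (fun j => F (unity_root N ^ j)) N) =
    c * (/ RtoC (INR (S N)) * sum_n (fun j => F (unity_root N ^ j)) N))%C. ring.
Qed.

Lemma mean_sum (N L : nat) (F : nat -> C -> C) :
  mean N (fun z => sum_n (fun m => F m z) L) = sum_n (fun m => mean N (F m)) L.
Proof.
  induction L as [|L IH].
  - rewrite sum_O. apply mean_ext. intros z _. now rewrite sum_O.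
  - rewrite sum_Sn, <- IH. change plus with Cplus.
    rewrite <- mean_plus. apply mean_ext. intros z _. now rewrite sum_Sn.
Qed.

Lemma mean_pow_trivial (N : nat) (p : nat) :
  (unity_root N ^ p)%C = RtoC 1 -> mean N (fun z => z ^ p)%C = RtoC 1.
Proof.
  intros H. unfold mean.
  assert (E : forall n, sum_n (fun j => (unity_root N ^ j) ^ p)%C n = RtoC (INR (S n))).
  { induction n as [|n IH].
    - rewrite sum_O. simpl. now rewrite Cpow_1_l.
    - rewrite sum_Sn, IH. rewrite <- Cpow_mult_r, Nat.mul_comm, Cpow_mult_r, H, Cpow_1_l.
      rewrite (S_INR (S n)), RtoC_plus. reflexivity. }
  rewrite E. apply Cinv_l. intros E'. injection E' as E'.
  exact (not_0_INR (S N) (Nat.neq_succ_0 N) E').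
Qed.

Lemma mean_pow_nontrivial (N : nat) (p : nat) :
  (unity_root N ^ p)%C <> RtoC 1 -> mean N (fun z => z ^ p)%C = RtoC 0.
Proof.
  intros H. unfold mean.
  assert (E : forall n, ((unity_root N ^ p - 1) * sum_n (fun j => (unity_root N ^ j) ^ p) n
     = (unity_root N ^ p) ^ S n - 1)%C).
  { induction n as [|n IH].
    - rewrite sum_O. simpl. rewrite Cpow_1_l. ring.
    - rewrite sum_Sn. change plus with Cplus.
      rewrite Cmult_plus_distr_l, IH.
      rewrite <- (Cpow_mult_r (unity_root N) (S n) p), Nat.mul_comm, Cpow_mult_r.
      rewrite (Cpow_S _ (S n)). ring. }
  specialize (E N).
  rewrite <- (Cpow_mult_r (unity_root N) p (S N)), Nat.mul_comm, Cpow_mult_r, unity_root_pow_order,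
    Cpow_1_l in E.
  assert (Z : @eq C (sum_n (fun j => (unity_root N ^ j) ^ p)%C N) (RtoC 0)).
  { assert (Hn : (unity_root N ^ p - 1)%C <> RtoC 0).
    { intros E0. apply H. replace (unity_root N ^ p)%C with ((unity_root N ^ p - 1) + 1)%C by ring.
      rewrite E0. ring. }
    replace (sum_n (fun j => (unity_root N ^ j) ^ p)%C N) with
     (/ (unity_root N ^ p - 1) * ((unity_root N ^ p - 1) * sum_n (fun j => (unity_root N ^ j) ^ p) N))%C
     by (field; exact Hn).
    rewrite E. ring. }
  rewrite Z. ring.
Qed.

(** Orthogonality of characters: the exponent is written modulo the order N + 1 of
    the group, with remainder p. *)
Lemma mean_pow (N p q : nat) : (p <= N)%nat ->
  mean N (fun z => z ^ (p + q * S N))%C = if Nat.eqb p 0 then RtoC 1 else RtoC 0.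
Proof.
  intros Hp.
  assert (E : (unity_root N ^ (p + q * S N))%C = (unity_root N ^ p)%C).
  { rewrite Cpow_add_r, (Nat.mul_comm q), Cpow_mult_r, unity_root_pow_order, Cpow_1_l. ring. }
  destruct (Nat.eqb_spec p 0) as [->|Hp0].
  - apply mean_pow_trivial. rewrite E. reflexivity.
  - apply mean_pow_nontrivial. rewrite E. apply unity_root_pow_neq_1. lia.
Qed.

Lemma Cmod_mean_le (N : nat) (F : C -> C) (B : C -> R) (m : R) :
  (forall z, Cmod z = 1 -> Cmod (F z) <= B z) ->
  mean N (fun z => RtoC (B z)) = RtoC m ->
  Cmod (mean N F) <= m.
Proof.
  intros H E.
  assert (HN : 0 < INR (S N)) by (apply lt_0_INR; lia).
  assert (Hr : forall n, sum_n (fun j => RtoC (B (unity_root N ^ j)%C)) n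
     = RtoC (sum_n (fun j => B (unity_root N ^ j)%C) n)).
  { induction n as [|n IH]; [now rewrite !sum_O|].
    rewrite !sum_Sn, IH, <- RtoC_plus. reflexivity. }
  assert (Hz : forall j, Cmod (unity_root N ^ j)%C = 1).
  { intros j. unfold unity_root. now rewrite Cmod_pow, Cmod_cis, pow1. }
  unfold mean in E. rewrite Hr, <- RtoC_inv, <- RtoC_mult in E by lra.
  injection E as E. rewrite <- E. unfold mean.
  rewrite Cmod_mult, <- RtoC_inv, Cmod_R, Rabs_pos_eq by
    first [lra | apply Rlt_le, Rinv_0_lt_compat, HN].
  apply Rmult_le_compat_l; [apply Rlt_le, Rinv_0_lt_compat, HN|].
  apply Cmod_sum_n_m. intros k. apply H, Hz.
Qed.

Lemma Cconj_RtoC (x : R) : Cconj (RtoC x) = RtoC x.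
Proof. unfold Cconj, RtoC; simpl. now rewrite Ropp_0. Qed.

Lemma unit_conj (z : C) : Cmod z = 1 -> (z * Cconj z)%C = RtoC 1.
Proof. intros H. rewrite <- Cmod2_conj, H. f_equal. ring. Qed.

Lemma mean_conj (N : nat) (F : C -> C) :
  mean N (fun z => Cconj (F z)) = Cconj (mean N F).
Proof.
  unfold mean. rewrite Cmult_conj, <- RtoC_inv by (apply not_0_INR; lia).
  rewrite Cconj_RtoC. f_equal.
  generalize N at 2 4. intros n. induction n as [|n IH]; [now rewrite !sum_O|].
  rewrite !sum_Sn, IH. symmetry. apply Cplus_conj.
Qed.

(** The squared modulus expands to 1 + |t|^2 plus t z^n and its conjugate, whose
    means vanish. *)
Lemma mean_kernel (N n : nat) (t : C) : (0 < n <= N)%nat ->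
  mean N (fun z => RtoC (Cmod (1 + t * z ^ n)%C ^ 2)) = RtoC (1 + Cmod t ^ 2).
Proof.
  intros Hn.
  assert (E0 : mean N (fun z => t * z ^ (n + 0 * S N))%C = RtoC 0).
  { rewrite mean_scal, mean_pow, (proj2 (Nat.eqb_neq _ 0)) by lia. ring. }
  rewrite (mean_ext N _ (fun z => (RtoC (1 + Cmod t ^ 2) * z ^ (0 + 0 * S N)
     + (t * z ^ (n + 0 * S N) + Cconj (t * z ^ (n + 0 * S N))))))%C.
  - rewrite !mean_plus, mean_conj, mean_scal, E0, mean_pow by lia.
    simpl Nat.eqb. cbv iota. rewrite Cconj_RtoC. ring.
  - intros z Hz. rewrite RtoC_plus, !Cmod2_conj.
    assert (Hzn : (z ^ n * Cconj (z ^ n))%C = RtoC 1)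
      by (apply unit_conj; now rewrite Cmod_pow, Hz, pow1).
    replace (n + 0 * S N)%nat with n by lia.
    rewrite Cplus_conj, !Cmult_conj, Cconj_RtoC.
    change (z ^ (0 + 0 * S N))%C with (RtoC 1).
    transitivity (1 + t * z ^ n + Cconj t * Cconj (z ^ n)
      + t * Cconj t * (z ^ n * Cconj (z ^ n)))%C; [ring|].
    rewrite Hzn. ring.
Qed.

(** * Coefficients of power series bounded by one *)

(** The mean of W(z) z^(-n) (1 + t z^n)^2 is W_n + 2 t W_0: the last term of the
    expanded kernel, t^2 z^n, only meets coefficients of negative index.  On the
    circle, the integrand is at most M |1 + t z^n|^2, of mean M (1 + |t|^2). *)
Lemma poly_coef_bound (W : nat -> C) (L n : nat) (M : R) (t : C) :
  (0 < n <= L)%nat ->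
  (forall z, Cmod z = 1 -> Cmod (sum_n (fun m => W m * z ^ m)%C L) <= M) ->
  Cmod (W n + 2 * t * W 0%nat) <= M * (1 + Cmod t ^ 2).
Proof.
  intros Hn HM.
  (* The exponents met below are m - n, m and m + n with m <= L; only 0 among them is a
     multiple of N + 1 = L + n + 1. *)
  set (N := (L + n)%nat).
  (* The exponent N + 1 - n stands for -n modulo the order N + 1. *)
  set (F := fun z : C => (sum_n (fun m => W m * z ^ m) L
     * (z ^ (S N - n) * ((1 + t * z ^ n) * (1 + t * z ^ n))))%C).
  replace (W n + 2 * t * W 0%nat)%C with (mean N F).
  - apply Cmod_mean_le with (B := fun z => M * Cmod (1 + t * z ^ n)%C ^ 2).
    + intros z Hz. unfold F. rewrite !Cmod_mult, Cmod_pow, Hz, pow1.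
      replace (1 * (Cmod (1 + t * z ^ n) * Cmod (1 + t * z ^ n)))
        with (Cmod (1 + t * z ^ n) ^ 2) by ring.
      apply Rmult_le_compat_r; [apply pow2_ge_0|]. now apply HM.
    + rewrite (mean_ext N _ (fun z => RtoC M * RtoC (Cmod (1 + t * z ^ n)%C ^ 2))%C)
        by (intros; now rewrite RtoC_mult).
      rewrite mean_scal, mean_kernel by lia. now rewrite RtoC_mult.
  - assert (Hterm : forall m, (m <= L)%nat ->
      mean N (fun z => W m * (z ^ m * (z ^ (S N - n) *
        ((1 + t * z ^ n) * (1 + t * z ^ n)))))%C
      = ((if Nat.eqb m n then W n else 0) + (if Nat.eqb m 0 then 2 * t * W 0%nat else 0))%C).
    { intros m Hm. rewrite mean_scal.
      rewrite (mean_ext N _ (fun z => (z ^ (m + (S N - n)) + (2 * t * z ^ (m + 1 * S N) +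
        t * t * z ^ (m + n + 1 * S N))))%C).
      2:{ intros z _.
          replace (m + 1 * S N)%nat with (m + (S N - n) + n)%nat by lia.
          replace (m + n + 1 * S N)%nat with (m + (S N - n) + n + n)%nat by lia.
          rewrite !(Cpow_add_r z). ring. }
      rewrite !mean_plus, !mean_scal, !(mean_pow N _ 1) by lia.
      rewrite (proj2 (Nat.eqb_neq (m + n) 0)) by lia.
      assert (E : mean N (fun z => z ^ (m + (S N - n)))%C
         = if Nat.eqb m n then RtoC 1 else RtoC 0).
      { destruct (Nat.le_gt_cases n m) as [Hnm|Hnm].
        - replace (m + (S N - n))%nat with ((m - n) + 1 * S N)%nat by lia.
          rewrite mean_pow by lia.
          destruct (Nat.eqb_spec m n) as [->|Hne].
          + now rewrite Nat.sub_diag.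
          + now rewrite (proj2 (Nat.eqb_neq (m - n) 0)) by lia.
        - replace (m + (S N - n))%nat with ((m + (S N - n)) + 0 * S N)%nat by lia.
          rewrite mean_pow by lia.
          rewrite !(proj2 (Nat.eqb_neq _ _)) by lia. reflexivity. }
      rewrite E.
      destruct (Nat.eqb_spec m n) as [E1|E1]; destruct (Nat.eqb_spec m 0) as [E2|E2];
        try lia; [rewrite E1|rewrite E2|]; ring. }
    transitivity (sum_n (fun m => ((if Nat.eqb m n then W n else 0) +
       (if Nat.eqb m 0 then 2 * t * W 0%nat else 0))%C) L).
    2:{ assert (G : forall K, @eq C (sum_n (fun m => ((if Nat.eqb m n then W n else 0) +
       (if Nat.eqb m 0 then 2 * t * W 0%nat else 0))%C) K)
          ((if Nat.leb n K then W n else 0) + 2 * t * W 0%nat)%C).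
        { induction K as [|K IH].
          - rewrite sum_O. destruct n; [lia|]. simpl. reflexivity.
          - rewrite sum_Sn, IH. change plus with Cplus.
            simpl (Nat.eqb (S K) 0). cbv iota.
            destruct (Nat.leb_spec n K), (Nat.leb_spec n (S K)), (Nat.eqb_spec (S K) n);
              try lia; ring. }
        rewrite G. destruct (Nat.leb_spec n L); [reflexivity|lia]. }
    rewrite <- (sum_n_ext_loc _ _ L Hterm), <- mean_sum.
    apply mean_ext. intros z _. unfold F.
    rewrite <- (sum_n_mult_r (K := C_Ring) _ (fun m => W m * z ^ m)%C L
       : sum_n (fun m => W m * z ^ m * _)%C L = (_ * _)%C).
    apply sum_n_ext. intros m. symmetry. apply Cmult_assoc.
Qed.

Lemma unimodular_factor (c : C) : exists u : C, Cmod u = 1 /\ (u * c)%C = RtoC (Cmod c).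
Proof.
  destruct (Req_dec (Cmod c) 0) as [E|E].
  - exists (RtoC 1). split; [apply Cmod_1|].
    rewrite E, (Cmod_eq_0 c E). ring.
  - assert (Hc : RtoC (Cmod c) <> RtoC 0) by (intros H; injection H; exact E).
    exists (Cconj c / RtoC (Cmod c))%C. split.
    + rewrite Cmod_div by exact Hc.
      rewrite Cmod_conj, Cmod_R, Rabs_pos_eq by apply Cmod_ge_0. field. exact E.
    + transitivity (c * Cconj c / RtoC (Cmod c))%C; [field; exact Hc|].
      rewrite <- Cmod2_conj. replace (Cmod c ^ 2) with (Cmod c * Cmod c) by ring.
      rewrite RtoC_mult. field. exact Hc.
Qed.

(** Take t = conj(W_0) conj(u), where the unimodular u rotates W_n to |W_n|; then
    u (W_n + 2 t W_0) = |W_n| + 2 |W_0|^2. *)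
Lemma poly_coef_const_coef_bound (W : nat -> C) (L n : nat) (M : R) :
  (0 < n <= L)%nat ->
  (forall z, Cmod z = 1 -> Cmod (sum_n (fun m => W m * z ^ m)%C L) <= M) ->
  Cmod (W n) + 2 * Cmod (W 0%nat) ^ 2 <= M * (1 + Cmod (W 0%nat) ^ 2).
Proof.
  intros Hn HM.
  destruct (unimodular_factor (W n)) as [u [Hu Huc]].
  pose proof (poly_coef_bound W L n M (Cconj (W 0%nat) * Cconj u)%C Hn HM) as H.
  rewrite (Cmod_mult (Cconj _)), !Cmod_conj, Hu, Rmult_1_r in H.
  eapply Rle_trans; [|exact H]. clear H.
  apply Req_le.
  rewrite <- (Rmult_1_l (Cmod (W n + _))), <- Hu, <- Cmod_mult.
  replace (u * (W n + 2 * (Cconj (W 0%nat) * Cconj u) * W 0%nat))%C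
    with (u * W n + 2 * (W 0%nat * Cconj (W 0%nat)) * (u * Cconj u))%C by ring.
  rewrite Huc, (unit_conj u Hu), <- Cmod2_conj.
  replace (RtoC (Cmod (W n)) + 2 * RtoC (Cmod (W 0%nat) ^ 2) * 1)%C
    with (RtoC (Cmod (W n) + 2 * Cmod (W 0%nat) ^ 2))
    by (rewrite RtoC_plus, RtoC_mult; ring).
  rewrite Cmod_R, Rabs_pos_eq; [reflexivity|].
  pose proof (Cmod_ge_0 (W n)). pose proof (pow2_ge_0 (Cmod (W 0%nat))). lra.
Qed.

Lemma bernoulli_sub (s : R) (n : nat) : 0 <= s <= 1 -> 1 - INR n * s <= (1 - s) ^ n.
Proof.
  intros Hs. induction n as [|n IH]; [simpl; lra|].
  rewrite S_INR. simpl. pose proof (pos_INR n).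
  apply (Rmult_le_compat_l (1 - s)) in IH; [|lra]. nra.
Qed.

(** A limit r -> 1 made quantitative by Bernoulli's inequality. *)
Lemma le_of_radial_le (x K : R) (n : nat) : 0 <= x ->
  (forall r, 0 <= r < 1 -> x * r ^ n <= K) -> x <= K.
Proof.
  intros Hx H. apply le_epsilon. intros eps He.
  set (d := INR n * x + 1). assert (Hd : 1 <= d) by (unfold d; pose proof (pos_INR n); nra).
  set (s := Rmin 1 (eps / d)).
  assert (Hs : 0 < s) by (apply Rmin_pos; [lra|apply Rdiv_lt_0_compat; lra]).
  assert (Hs1 : s <= 1) by apply Rmin_l.
  assert (Hs2 : s * d <= eps).
  { pose proof (Rmin_r 1 (eps / d)) as A. fold s in A.
    apply (Rmult_le_compat_r d) in A; [|lra].
    replace (eps / d * d) with eps in A by (field; lra). exact A. }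
  specialize (H (1 - s)). pose proof (bernoulli_sub s n (conj (Rlt_le _ _ Hs) Hs1)) as B.
  apply (Rmult_le_compat_l x) in B; [|lra]. unfold d in Hs2. nra.
Qed.

(** For r < 1, a long enough truncation of the series at r z differs by at most e from
    the sum on the whole circle, so [poly_coef_const_coef_bound] applies with M = 1 + e. *)
Lemma bounded_power_series_coef (c : nat -> C) (n : nat) :
  disc_summable c ->
  (forall z l, in_disc z -> is_Cseries (fun k => c k * z ^ k)%C l -> Cmod l <= 1) ->
  (0 < n)%nat -> Cmod (c n) <= 1 - Cmod (c 0%nat) ^ 2.
Proof.
  intros Hc Hb Hn.
  apply le_of_radial_le with (n := n); [apply Cmod_ge_0|]. intros r Hr.
  set (q := Cmod (c 0%nat) ^ 2). assert (Hq : 0 <= q) by apply pow2_ge_0.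
  (* The power r^0 = 1 leaves the constant term unscaled, so only the n-th gets r^n. *)
  cut (Cmod (c n) * r ^ n + 2 * q <= 1 + q); [lra|].
  apply le_epsilon. intros eps He.
  set (v := fun k => Cmod (c k) * r ^ k).
  destruct (Hc r Hr) as [s Hs]. fold v in Hs.
  set (e := eps / (1 + q)). assert (He' : 0 < e) by (apply Rdiv_lt_0_compat; lra).
  pose proof (proj1 (filterlim_locally _ _) Hs (mkposreal e He')) as [K HK].
  specialize (HK (K + n)%nat ltac:(lia)). set (L := (K + n)%nat) in *.
  change (Rabs (sum_n v L - s) < e) in HK. apply Rabs_def2 in HK.
  set (W := fun k => (c k * RtoC (r ^ k))%C).
  assert (P : Cmod (W n) + 2 * Cmod (W 0%nat) ^ 2 <= (1 + e) * (1 + Cmod (W 0%nat) ^ 2)).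
  { apply poly_coef_const_coef_bound with (L := L); [unfold L; lia|].
    intros z Hz.
    set (x := (RtoC r * z)%C).
    assert (Hx : in_disc x).
    { unfold in_disc, x. rewrite Cmod_mult, Hz, Cmod_R, Rabs_pos_eq; lra. }
    destruct (disc_summable_ex c x Hc Hx) as [l Hl].
    pose proof (Hb x l Hx Hl) as Hl1.
    assert (Hterm : forall k, Cmod (c k * x ^ k)%C <= v k).
    { intros k. unfold v, x. rewrite Cmod_mult, Cmod_pow, Cmod_mult, Hz, Cmod_R,
        Rabs_pos_eq, Rmult_1_r by lra. apply Rle_refl. }
    pose proof (Cmod_tail_le _ l v s L Hterm Hl Hs) as T.
    rewrite (sum_n_ext (fun m => W m * z ^ m)%C (fun k => c k * x ^ k)%C).
    2:{ intros k. unfold W, x. rewrite Cpow_mult_l, RtoC_pow. symmetry. apply Cmult_assoc. }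
    set (p := sum_n (fun k => (c k * x ^ k)%C) L) in *.
    replace p with (l + - (l - p))%C by ring.
    eapply Rle_trans; [apply Cmod_triangle|]. rewrite Cmod_opp. lra. }
  unfold W in P. rewrite !Cmod_mult, !Cmod_R, !Rabs_pos_eq in P by (apply pow_le; lra).
  simpl (r ^ 0) in P. rewrite Rmult_1_r in P. fold q in P.
  replace ((1 + e) * (1 + q)) with (1 + q + eps) in P by (unfold e; field; lra).
  exact P.
Qed.

(** * Division of power series *)

(** Solves a * x = b for the Cauchy product when a_0 = 1.  The fuel only makes the
    course-of-values recursion structural; any fuel at least n gives the same value
    ([quotient_fuel_stable]). *)
Fixpoint quotient_fuel (a b : nat -> C) (fuel n : nat) : C :=
  match fuel, n with
  | S f, S m =>
      (b n - sum_n (fun i => a (S i) * quotient_fuel a b f (m - i)) m)%C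
  | _, _ => b n
  end.

Definition quotient_coef (a b : nat -> C) (n : nat) : C := quotient_fuel a b n n.

Lemma quotient_fuel_stable (a b : nat -> C) (f g n : nat) :
  (n <= f)%nat -> (n <= g)%nat -> quotient_fuel a b f n = quotient_fuel a b g n.
Proof.
  revert g n. induction f as [|f IH]; intros g n Hf Hg.
  - replace n with 0%nat by lia. now destruct g.
  - destruct n as [|m]; [now destruct g|]. destruct g as [|g]; [lia|].
    simpl. f_equal. apply sum_n_ext_loc. intros i Hi. f_equal. apply IH; lia.
Qed.

Lemma quotient_coef_0 (a b : nat -> C) : quotient_coef a b 0 = b 0%nat.
Proof. reflexivity. Qed.

Lemma quotient_coef_S (a b : nat -> C) (m : nat) :
  quotient_coef a b (S m) =
  (b (S m) - sum_n (fun i => a (S i) * quotient_coef a b (m - i)) m)%C.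
Proof.
  unfold quotient_coef at 1. simpl. f_equal.
  apply sum_n_ext_loc. intros i Hi. f_equal. apply quotient_fuel_stable; lia.
Qed.

Lemma Cauchy_coef_quotient (a b : nat -> C) (n : nat) :
  a 0%nat = RtoC 1 -> Cauchy_coef a (quotient_coef a b) n = b n.
Proof.
  intros Ha. unfold Cauchy_coef. destruct n as [|m].
  - rewrite sum_O. simpl. rewrite Ha, quotient_coef_0. ring.
  - unfold sum_n. rewrite sum_Sn_m by lia. rewrite <- sum_n_m_S.
    change plus with Cplus. fold (sum_n (fun i => (a (S i) * quotient_coef a b (S m - S i))%C) m).
    simpl (S m - 0)%nat. rewrite Ha, quotient_coef_S.
    simpl (S m - S _)%nat. ring.
Qed.

(** If T bounds all earlier quotient coefficients, then the n-th one is at most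
    |b_n| + T, because the coefficients a_1, a_2, ... have absolute sum at most 1; T is
    the sum of the earlier |b_k|. *)
Lemma quotient_coef_le (a b : nat -> C) (n : nat) :
  (forall m, sum_n (fun i => Cmod (a (S i))) m <= 1) ->
  Cmod (quotient_coef a b n) <= sum_n (fun k => Cmod (b k)) n.
Proof.
  intros Ha. induction n as [n IH] using (well_founded_ind Nat.lt_wf_0). destruct n as [|m].
  - rewrite quotient_coef_0, sum_O. apply Rle_refl.
  - rewrite quotient_coef_S, sum_Sn. change plus with Rplus.
    set (T := sum_n (fun k => Cmod (b k)) m).
    unfold Cminus. eapply Rle_trans; [apply Cmod_triangle|]. rewrite Cmod_opp, Rplus_comm.
    apply Rplus_le_compat_r.
    assert (Hmono : forall j d, sum_n (fun k => Cmod (b k)) j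
        <= sum_n (fun k => Cmod (b k)) (j + d)).
    { intros j d. induction d as [|d IHd]; [rewrite Nat.add_0_r; apply Rle_refl|].
      rewrite Nat.add_succ_r, sum_Sn. change plus with Rplus.
      pose proof (Cmod_ge_0 (b (S (j + d)))). lra. }
    assert (HT : forall i, (i <= m)%nat -> Cmod (quotient_coef a b (m - i)) <= T).
    { intros i Hi. eapply Rle_trans; [apply IH; lia|].
      unfold T. replace m with ((m - i) + i)%nat at 2 by lia. apply Hmono. }
    assert (HT0 : 0 <= T) by (eapply Rle_trans; [apply Cmod_ge_0|apply (HT 0%nat); lia]).
    eapply Rle_trans;
      [exact (@norm_sum_n_m C_AbsRing C_NormedModule _ 0 m)|].
    apply Rle_trans with (sum_n (fun i => Cmod (a (S i)) * T) m).
    + assert (G : forall K, (K <= m)%nat ->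
        sum_n (fun i => Cmod (a (S i) * quotient_coef a b (m - i))%C) K
        <= sum_n (fun i => Cmod (a (S i)) * T) K).
      { induction K as [|K IHK]; intros HK.
        - rewrite !sum_O, Cmod_mult. apply Rmult_le_compat_l; [apply Cmod_ge_0|now apply HT].
        - rewrite !sum_Sn. apply Rplus_le_compat; [apply IHK; lia|].
          rewrite Cmod_mult. apply Rmult_le_compat_l; [apply Cmod_ge_0|now apply HT]. }
      exact (G m (le_n m)).
    + rewrite (sum_n_mult_r (K := R_Ring) T (fun i => Cmod (a (S i))) m
        : sum_n (fun i => Cmod (a (S i)) * T) m = (_ * _)).
      change (sum_n (fun i => Cmod (a (S i))) m * T <= T). specialize (Ha m). nra.
Qed.

(** By [quotient_coef_le] the quotient is majorised by the product of the series |b|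
    and the geometric series. *)
Lemma quotient_summable (a b : nat -> C) :
  (forall m, sum_n (fun i => Cmod (a (S i))) m <= 1) ->
  disc_summable b -> disc_summable (quotient_coef a b).
Proof.
  intros Ha Hb r Hr.
  assert (Hg : ex_series (fun n => r ^ n)).
  { apply ex_series_geom. rewrite Rabs_pos_eq; lra. }
  destruct (Hb r Hr) as [s Hs]. destruct Hg as [g Hg].
  pose proof (is_series_mult_pos _ _ _ _ Hs Hg) as H.
  assert (Hex : ex_series (fun n => sum_f_R0
     (fun k => Cmod (b k) * r ^ k * r ^ (n - k)) n)).
  { eexists. apply H; intros n; repeat apply Rmult_le_pos;
      first [apply Cmod_ge_0 | apply pow_le; lra]. }
  revert Hex. apply (@ex_series_le R_AbsRing R_CompleteNormedModule).
  intros n. change (Rabs (Cmod (quotient_coef a b n) * r ^ n) <=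
     sum_f_R0 (fun k => Cmod (b k) * r ^ k * r ^ (n - k)) n).
  assert (Hp : 0 <= r ^ n) by (apply pow_le; lra).
  rewrite Rabs_pos_eq by (apply Rmult_le_pos; [apply Cmod_ge_0|assumption]).
  rewrite (sum_eq _ (fun k => Cmod (b k) * r ^ n)).
  - rewrite <- scal_sum, <- sum_n_Reals, Rmult_comm.
    apply Rmult_le_compat_l; [assumption|]. now apply quotient_coef_le.
  - intros k Hk. rewrite Rmult_assoc, <- pow_add. do 2 f_equal. lia.
Qed.

Lemma Cauchy_coef_pow (a b : nat -> C) (z : C) (n : nat) :
  Cauchy_coef (fun k => a k * z ^ k)%C (fun k => b k * z ^ k)%C n
  = (Cauchy_coef a b n * z ^ n)%C.
Proof.
  unfold Cauchy_coef.
  etransitivity;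
    [|exact (sum_n_mult_r (K := C_Ring) (z ^ n)%C (fun k => a k * b (n - k)%nat)%C n)].
  apply sum_n_ext_loc. intros k Hk.
  replace (z ^ n)%C with (z ^ k * z ^ (n - k))%C
    by (rewrite <- Cpow_add_r; f_equal; lia).
  change ((a k * z ^ k * (b (n - k)%nat * z ^ (n - k)))%C =
    (a k * b (n - k)%nat * (z ^ k * z ^ (n - k)))%C). ring.
Qed.

(** * Coefficient bounds for the two parts of the harmonic map *)

(** The formal quotient w of g' by h' sums to g'/h', which is bounded by 1 in modulus. *)
Lemma dilatation_coefs (a b : nat -> C) (h g : C -> C) :
  power_series_on_disc a h -> power_series_on_disc b g -> a 1%nat = RtoC 1 ->
  (forall m, sum_n (fun i => INR (i + 2) * Cmod (a (i + 2)%nat)) m <= 1) ->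
  (forall z, in_disc z -> Cmod (C_derive g z) < Cmod (C_derive h z)) ->
  exists w : nat -> C,
    (forall n, Cauchy_coef (deriv_coef a) w n = deriv_coef b n) /\
    (forall n, (0 < n)%nat -> Cmod (w n) <= 1 - Cmod (b 1%nat) ^ 2).
Proof.
  intros Ha Hb Ha1 Hsum Hlt.
  assert (HD0 : forall c : nat -> C, deriv_coef c 0%nat = c 1%nat)
    by (intros c; unfold deriv_coef; simpl; ring).
  assert (Hq : forall m, sum_n (fun i => Cmod (deriv_coef a (S i))) m <= 1).
  { intros m. rewrite (sum_n_ext _ (fun i => INR (i + 2) * Cmod (a (i + 2)%nat))).
    - apply Hsum.
    - intros i. rewrite Cmod_deriv_coef. now replace (i + 2)%nat with (S (S i)) by lia. }
  pose proof (disc_summable_deriv_coef _ (power_series_summable _ _ Ha)) as Sa.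
  pose proof (disc_summable_deriv_coef _ (power_series_summable _ _ Hb)) as Sb.
  pose proof (quotient_summable _ _ Hq Sb) as Sw.
  set (w := quotient_coef (deriv_coef a) (deriv_coef b)) in *.
  assert (E : forall n, Cauchy_coef (deriv_coef a) w n = deriv_coef b n).
  { intros n. apply Cauchy_coef_quotient. now rewrite HD0. }
  exists w. split; [exact E|].
  intros n Hn.
  rewrite <- (HD0 b), <- (quotient_coef_0 (deriv_coef a) (deriv_coef b)). fold w.
  apply bounded_power_series_coef; [exact Sw| |exact Hn].
  intros z l Hz Hl.
  pose proof (C_derive_series a h z Ha Hz) as Dh.
  pose proof (C_derive_series b g z Hb Hz) as Dg.
  pose proof (is_Cseries_mult _ _ _ _ Dh Hl (disc_summable_abs _ _ Sa Hz)
    (disc_summable_abs _ _ Sw Hz)) as P.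
  assert (P' : is_Cseries (fun n => deriv_coef b n * z ^ n)%C (C_derive h z * l)%C).
  { revert P. apply is_series_ext. intros k. now rewrite Cauchy_coef_pow, E. }
  pose proof (is_Cseries_unique _ _ _ Dg P') as Q.
  specialize (Hlt z Hz). rewrite Q, Cmod_mult in Hlt.
  pose proof (Cmod_ge_0 (C_derive h z)). pose proof (Cmod_ge_0 l). nra.
Qed.

Lemma partial_sum_le (v : nat -> R) (N : nat) :
  (forall n, 0 <= v n) -> ex_series v -> sum_n v N <= Series v.
Proof.
  intros Hv Hex.
  apply (is_lim_seq_incr_compare (sum_n v) (Series v)).
  - exact (Series_correct v Hex).
  - intros n. rewrite sum_Sn. change plus with Rplus. specialize (Hv (S n)). lra.
Qed.

Lemma term_le_Series (v : nat -> R) (N : nat) :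
  (forall n, 0 <= v n) -> ex_series v -> v N <= Series v.
Proof.
  intros Hv Hex. eapply Rle_trans; [|exact (partial_sum_le v N Hv Hex)].
  destruct N as [|N]; [rewrite sum_O; apply Rle_refl|].
  rewrite sum_Sn. change plus with Rplus.
  assert (0 <= sum_n v N); [|lra].
  clear Hex. induction N as [|N IH]; [rewrite sum_O; apply Hv|].
  rewrite sum_Sn. change plus with Rplus. specialize (Hv (S N)). lra.
Qed.

(** In n b_n = sum_(k = 1)^n k a_k w_(n - k), the term k = n carries w_0, of modulus
    beta; all others carry coefficients bounded by 1 - beta^2. *)
Lemma coef_bound_of_convolution (a b w : nat -> C) (beta : R) (n : nat) :
  (forall m, Cauchy_coef (deriv_coef a) w m = deriv_coef b m) ->
  a 1%nat = RtoC 1 -> Cmod (b 1%nat) = beta ->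
  (forall m, (0 < m)%nat -> Cmod (w m) <= 1 - beta ^ 2) ->
  (2 <= n)%nat ->
  Cmod (b n) <= (1 - beta ^ 2) / INR n * sum_n_m (fun k => INR k * Cmod (a k)) 1 (n - 1)
     + beta * Cmod (a n).
Proof.
  intros E Ha1 Hb1 Hw Hn.
  assert (Hw0 : Cmod (w 0%nat) = beta).
  { rewrite <- Hb1. f_equal. pose proof (E 0%nat) as E0.
    unfold Cauchy_coef in E0. rewrite sum_O in E0. unfold deriv_coef in E0. simpl in E0.
    rewrite Ha1 in E0. transitivity (1 * 1 * w 0%nat)%C; [ring|]. rewrite E0. ring. }
  destruct n as [|[|p]]; [lia|lia|]. clear Hn.
  assert (Hpos : 0 < INR (S (S p))) by (apply lt_0_INR; lia).
  assert (Hmain : INR (S (S p)) * Cmod (b (S (S p))) <=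
     (1 - beta ^ 2) * sum_n_m (fun k => INR k * Cmod (a k)) 1 (S p)
       + INR (S (S p)) * Cmod (a (S (S p))) * beta).
  { rewrite <- !Cmod_deriv_coef, <- E. unfold Cauchy_coef.
    rewrite sum_Sn. change plus with Cplus. rewrite Nat.sub_diag.
    eapply Rle_trans; [apply Cmod_triangle|].
    rewrite (Cmod_mult (deriv_coef a (S p))), Hw0.
    apply Rplus_le_compat_r.
    rewrite <- sum_n_m_S. fold (sum_n (fun k => INR (S k) * Cmod (a (S k))) p).
    assert (G : forall K, (K <= p)%nat ->
      Cmod (sum_n (fun k => deriv_coef a k * w (S p - k)%nat)%C K) <=
      (1 - beta ^ 2) * sum_n (fun k => INR (S k) * Cmod (a (S k))) K).
    { assert (Hterm : forall k, (k <= p)%nat -> Cmod (deriv_coef a k * w (S p - k)%nat)%C <=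
        (1 - beta ^ 2) * (INR (S k) * Cmod (a (S k)))).
      { intros k Hk. rewrite Cmod_mult, <- Cmod_deriv_coef, Rmult_comm.
        apply Rmult_le_compat_r; [apply Cmod_ge_0|]. apply Hw. lia. }
      induction K as [|K IH]; intros HK; [rewrite !sum_O; now apply Hterm|].
      rewrite !sum_Sn. change (@plus C_AbelianMonoid) with Cplus.
      change (@plus R_AbelianMonoid) with Rplus.
      eapply Rle_trans; [apply Cmod_triangle|]. rewrite Rmult_plus_distr_l.
      apply Rplus_le_compat; [apply IH; lia|now apply Hterm]. }
    apply G, le_n. }
  replace (S (S p) - 1)%nat with (S p) by lia.
  apply Rmult_le_reg_l with (INR (S (S p))); [exact Hpos|].
  eapply Rle_trans; [exact Hmain|]. apply Req_le. field. lra.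
Qed.

(** As delta >= 0 and 0 <= alpha < 1, the weight n^delta (n - alpha) / (1 - alpha) is
    at least n, which gives the first claim; dropping all terms but one gives the
    second for n >= 2, while for n = 1 it is an equality. *)
Lemma class_S_coefs (delta alpha : R) (a : nat -> C) :
  0 <= alpha < 1 -> 0 <= delta -> a 1%nat = RtoC 1 ->
  let v := fun k => Rpower (INR (k + 2)) delta * ((INR (k + 2) - alpha) / (1 - alpha))
             * Cmod (a (k + 2)%nat) in
  ex_series v -> Series v <= 1 ->
  (forall m, sum_n (fun i => INR (i + 2) * Cmod (a (i + 2)%nat)) m <= 1) /\
  (forall n, (1 <= n)%nat ->
     Cmod (a n) <= (1 - alpha) / (Rpower (INR n) delta * (INR n - alpha))).
Proof.
  intros Halpha Hdelta Ha1 v Hex Hle.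
  assert (Hn2 : forall k, 2 <= INR (k + 2)).
  { intros k. rewrite plus_INR. pose proof (pos_INR k). simpl. lra. }
  assert (Hpw : forall k, 1 <= Rpower (INR (k + 2)) delta).
  { intros k. specialize (Hn2 k). rewrite <- (Rpower_O (INR (k + 2))) by lra.
    apply Rle_Rpower; lra. }
  assert (Hfac : forall k, INR (k + 2) <= (INR (k + 2) - alpha) / (1 - alpha)).
  { intros k. specialize (Hn2 k). apply Rmult_le_reg_r with (1 - alpha); [lra|].
    unfold Rdiv. rewrite Rmult_assoc, Rinv_l by lra. nra. }
  assert (Hterm : forall k, INR (k + 2) * Cmod (a (k + 2)%nat) <= v k).
  { intros k. unfold v. apply Rmult_le_compat_r; [apply Cmod_ge_0|].
    specialize (Hn2 k). specialize (Hpw k). specialize (Hfac k). nra. }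
  assert (Hv : forall k, 0 <= v k).
  { intros k. eapply Rle_trans; [|apply Hterm].
    apply Rmult_le_pos; [apply pos_INR|apply Cmod_ge_0]. }
  split.
  - intros m. eapply Rle_trans; [|exact Hle].
    eapply Rle_trans; [|exact (partial_sum_le v m Hv Hex)].
    apply sum_n_m_le. exact Hterm.
  - intros n Hn. destruct n as [|[|k]]; [lia| |].
    + rewrite Ha1, Cmod_1. simpl INR. unfold Rpower. rewrite ln_1, Rmult_0_r, exp_0.
      apply Req_le. field. lra.
    + replace (S (S k)) with (k + 2)%nat by lia.
      pose proof (term_le_Series v k Hv Hex) as T.
      specialize (Hn2 k). specialize (Hpw k).
      assert (Hd : 0 < Rpower (INR (k + 2)) delta * (INR (k + 2) - alpha)) by nra.
      apply Rmult_le_reg_r with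
        (Rpower (INR (k + 2)) delta * (INR (k + 2) - alpha) / (1 - alpha));
        [apply Rdiv_lt_0_compat; lra|].
      replace ((1 - alpha) / (Rpower (INR (k + 2)) delta * (INR (k + 2) - alpha)) *
        (Rpower (INR (k + 2)) delta * (INR (k + 2) - alpha) / (1 - alpha))) with 1
        by (field; lra).
      eapply Rle_trans; [|eapply Rle_trans; [exact T|exact Hle]].
      apply Req_le. unfold v. field. lra.
Qed.

Theorem theorem2p1 (alpha beta delta : R)
    (Halpha : 0 <= alpha < 1) (Hbeta : 0 <= beta < 1) (Hdelta : 0 <= delta)
    (f h g : C -> C) (Hf : class_SH delta alpha beta f h g)
    (a b : nat -> C)
    (Ha : power_series_on_disc a h) (Hb : power_series_on_disc b g) :
  Cmod (b 2%nat) <=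
    (1 - alpha) * beta / (Rpower 2 delta * (2 - alpha)) + (1 - beta ^ 2) / 2 /\
  forall n : nat, (3 <= n)%nat ->
    Cmod (b n) <=
      (1 - alpha) * (1 - beta ^ 2) / INR n *
        sum_n_m (fun k : nat => Rpower (INR k) (1 - delta) / (INR k - alpha)) 1 (n - 1)
      + (1 - alpha) * beta / (Rpower (INR n) delta * (INR n - alpha)).
Proof.
  destruct Hf as [[_ [_ [_ [_ [_ Hlt]]]]] [[_ [a' [Ha' [_ [Ha1 [Hex Hle]]]]]] [b' [Hb' Hb1]]]].
  (* Both expansions of g have linear coefficient g'(0), so beta = |b_1| for b itself. *)
  assert (Hbeta1 : Cmod (b 1%nat) = beta)
    by now rewrite <- (C_derive_0 b g Hb), (C_derive_0 b' g Hb').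
  destruct (class_S_coefs delta alpha a' Halpha Hdelta Ha1 Hex Hle) as [Hsum Hcoef].
  destruct (dilatation_coefs a' b h g Ha' Hb Ha1 Hsum Hlt) as [w [Hw Hwle]].
  rewrite Hbeta1 in Hwle.
  assert (Hmain := fun n => coef_bound_of_convolution a' b w beta n Hw Ha1 Hbeta1 Hwle).
  assert (Hb2 : 0 <= 1 - beta ^ 2) by nra.
  assert (Hlast : forall n, (1 <= n)%nat -> beta * Cmod (a' n) <=
     (1 - alpha) * beta / (Rpower (INR n) delta * (INR n - alpha))).
  { intros n Hn. specialize (Hcoef n Hn).
    apply (Rmult_le_compat_l beta) in Hcoef; [|lra].
    eapply Rle_trans; [exact Hcoef|]. apply Req_le. unfold Rdiv. ring. }
  split.
  - specialize (Hmain 2%nat (le_n 2)). specialize (Hlast 2%nat ltac:(lia)).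
    change (2 - 1)%nat with 1%nat in Hmain. rewrite sum_n_n, Ha1, Cmod_1 in Hmain.
    simpl INR in *. replace (1 + 1) with 2 in * by ring. lra.
  - intros n Hn. specialize (Hmain n ltac:(lia)). specialize (Hlast n ltac:(lia)).
    assert (HN : 0 < INR n) by (apply lt_0_INR; lia).
    eapply Rle_trans; [exact Hmain|]. apply Rplus_le_compat; [|exact Hlast].
    replace ((1 - alpha) * (1 - beta ^ 2) / INR n * _) with
      ((1 - beta ^ 2) / INR n * ((1 - alpha) *
        sum_n_m (fun k : nat => Rpower (INR k) (1 - delta) / (INR k - alpha)) 1 (n - 1)))
      by (unfold Rdiv; ring).
    apply Rmult_le_compat_l.
    { apply Rmult_le_pos; [exact Hb2|apply Rlt_le, Rinv_0_lt_compat, HN]. }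
    eapply Rle_trans;
      [|apply Req_le; exact (sum_n_m_mult_l (K := R_Ring) (1 - alpha) _ 1 (n - 1))].
    replace (n - 1)%nat with (S (n - 2)) by lia.
    rewrite <- !sum_n_m_S. apply sum_n_m_le. intros k.
    specialize (Hcoef (S k) ltac:(lia)).
    assert (Hk : 1 <= INR (S k)) by (apply (le_INR 1); lia).
    apply (Rmult_le_compat_l (INR (S k))) in Hcoef; [|lra].
    eapply Rle_trans; [exact Hcoef|]. apply Req_le.
    assert (HR : 0 < Rpower (INR (S k)) delta) by apply exp_pos.
    change (INR (S k) * ((1 - alpha) / (Rpower (INR (S k)) delta * (INR (S k) - alpha)))
      = (1 - alpha) * (Rpower (INR (S k)) (1 - delta) / (INR (S k) - alpha))).
    replace (1 - delta) with (1 + - delta) by ring.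
    rewrite Rpower_plus, Rpower_Ropp, Rpower_1 by lra.
    field. lra.
Qed.
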